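(* Let $n > m \geq 2$ be integers, let $A \subset \{0,1,\ldots,n-1\}\times\{0,1,\ldots,m-1\}$ be non-empty, and let $$S = S(A) = \left\{ \left( \sum_{i=1}^{\infty} \frac{x_i}{n^i},\ \sum_{i=1}^{\infty} \frac{y_i}{m^i} \right) : (x_i,y_i) \in A \text{ for all } i \geq 1 \right\} \subset \mathbb{R}^2 .$$ For $0 \leq j < m$ let $t_j$ be the number of elements of $A$ of the form $(i,j)$, let $s = |\{j : t_j \neq 0\}|$, and let $t = \max\{t_j : 0 \leq j < m\}$. Then the Assouad dimension of $S$ is $$\dim_A(S) = \log_m(s) + \log_n(t).$$
   Context: The set $S\subset\mathbb{R}^2$ carries the Euclidean metric. The Assouad dimension $\dim_A(X)$ of a metric space $X$ is the infimum of all $\alpha>0$ for which there exists a constant $C>0$ such that for any $r,R$ with $0 < r \leq \frac12 R \leq \operatorname{diam}(X)$, any ball $B(x,R)\subset X$ may be covered by at most $C (R/r)^\alpha$ balls of radius $r$. *)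

(* Defs.v *)
From HB Require Import structures.
From mathcomp Require Import all_boot all_order all_algebra ring.
From mathcomp Require Import all_classical all_reals all_analysis.
Import Order.TTheory GRing.Theory Num.Theory.
Import numFieldNormedType.Exports.

Set Implicit Arguments.
Unset Strict Implicit.
Unset Printing Implicit Defensive.

Local Open Scope classical_set_scope.
Local Open Scope ring_scope.

(* An alias, because the library's own balls on [R * R] are those of the sup
   metric. *)
Definition plane (R : realType) : Type := (R * R)%type.

HB.instance Definition _ (R : realType) := Choice.on (plane R).

Section EuclideanMetric.
Context {R : realType}.
Implicit Types p q : plane R.

Definition euclidean_dist p q : R :=
  Num.sqrt ((p.1 - q.1) ^+ 2 + (p.2 - q.2) ^+ 2).

Lemma euclidean_distxx p : euclidean_dist p p = 0.
Proof. by rewrite /euclidean_dist !subrr expr0n /= addr0 sqrtr0. Qed.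

Lemma euclidean_dist_positivity p q : euclidean_dist p q = 0 -> p = q.
Proof.
case: p q => [a b] [c d] /eqP.
rewrite sqrtr_eq0 /= => h.
have /eqP : (a - c) ^+ 2 + (b - d) ^+ 2 = 0.
  by apply/eqP; rewrite eq_le h addr_ge0 ?sqr_ge0.
rewrite paddr_eq0 ?sqr_ge0 // !sqrf_eq0 !subr_eq0.
by case/andP => /eqP -> /eqP ->.
Qed.

Lemma euclidean_dist_sym p q : euclidean_dist p q = euclidean_dist q p.
Proof.
by rewrite /euclidean_dist -(opprB q.1) -(opprB q.2) !sqrrN.
Qed.

Lemma sqrt_add_sqr_triangle (a b c d : R) :
  Num.sqrt ((a + c) ^+ 2 + (b + d) ^+ 2) <=
  Num.sqrt (a ^+ 2 + b ^+ 2) + Num.sqrt (c ^+ 2 + d ^+ 2).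
Proof.
set x := a ^+ 2 + b ^+ 2; set y := c ^+ 2 + d ^+ 2.
have x0 : 0 <= x by rewrite addr_ge0 ?sqr_ge0.
have y0 : 0 <= y by rewrite addr_ge0 ?sqr_ge0.
have s0 : 0 <= Num.sqrt x + Num.sqrt y by rewrite addr_ge0 ?sqrtr_ge0.
rewrite -[leRHS]ger0_norm // -sqrtr_sqr; apply: ler_wsqrtr.
rewrite [leRHS]sqrrD !sqr_sqrtr // -sqrtrM //.
have -> : (a + c) ^+ 2 + (b + d) ^+ 2 = x + (a * c + b * d) *+ 2 + y.
  by rewrite /x /y; ring.
rewrite lerD2r lerD2l lerMn2r /=.
apply: (le_trans (ler_norm _)); rewrite -sqrtr_sqr; apply: ler_wsqrtr.
have -> : x * y = (a * c + b * d) ^+ 2 + (a * d - b * c) ^+ 2.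
  by rewrite /x /y; ring.
by rewrite lerDl sqr_ge0.
Qed.

Lemma euclidean_dist_triangle q p u :
  euclidean_dist p u <= euclidean_dist p q + euclidean_dist q u.
Proof.
rewrite /euclidean_dist.
have -> : p.1 - u.1 = (p.1 - q.1) + (q.1 - u.1) by ring.
have -> : p.2 - u.2 = (p.2 - q.2) + (q.2 - u.2) by ring.
exact: sqrt_add_sqr_triangle.
Qed.

HB.instance Definition _ := isMetric.Build R (plane R)
  euclidean_distxx euclidean_dist_positivity euclidean_dist_sym
  euclidean_dist_triangle.

End EuclideanMetric.

(* The library makes a subset a pseudometric space, with the restricted balls;
   the following turns it into a metric space, with the restricted distance. *)
Section SubsetMetric.
Context {R : realType} {X : metricType R} (A : set X).

Definition set_mdist (x y : A) : R := mdist (set_val x) (set_val y).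

Lemma set_mdist_ge0 x y : 0 <= set_mdist x y.
Proof. exact: mdist_ge0. Qed.

Lemma set_mdist_positivity x y : set_mdist x y = 0 -> x = y.
Proof. by move/mdist_positivity/val_inj. Qed.

Lemma set_ballEmdist (x : A) d : ball x d = [set y | set_mdist x y < d].
Proof. by rewrite -initial_ballE ballEmdist. Qed.

HB.instance Definition _ := @PseudoMetric_isMetric.Build R (A : Type)
  set_mdist set_mdist_ge0 set_mdist_positivity set_ballEmdist.

End SubsetMetric.

Section AssouadDimension.
Context {R : realType} (X : metricType R).

Local Open Scope ereal_scope.

Definition diameter : \bar R :=
  ereal_sup [set d | exists x y : X, d = (mdist x y)%:E].

Definition assouad_bound (alpha : R) : Prop :=
  exists2 C : R, (0 < C)%R &
    forall r rho : R, (0 < r)%R -> (r <= rho / 2)%R ->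
      (rho / 2)%:E <= diameter ->
      forall x : X, exists2 s : seq X,
        ((size s)%:R <= C * (rho / r) `^ alpha)%R &
        ball x rho `<=` \bigcup_(c in [set` s]) ball c r.

Definition assouad_dim : \bar R :=
  ereal_inf [set alpha%:E | alpha in
    [set alpha : R | (0 < alpha)%R /\ assouad_bound alpha]].

End AssouadDimension.

Definition logb {R : realType} (b x : R) : R := ln x / ln b.

Definition digit_series (R : realType) (b : nat) (d : nat -> nat) : R :=
  limn (fun N => \sum_(1 <= i < N) ((d i)%:R / b%:R ^+ i : R)).

Section Carpet.
Variables (n m : nat) (A : {set 'I_n * 'I_m}).

Definition carpet_point (R : realType) (a : nat -> 'I_n * 'I_m) : plane R :=
  (digit_series R n (fun i => (a i).1), digit_series R m (fun i => (a i).2)).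

Definition carpet (R : realType) : set (plane R) :=
  [set carpet_point R a | a in
    [set a : nat -> 'I_n * 'I_m | forall i, (1 <= i)%N -> a i \in A]].

Definition row_count (j : 'I_m) : nat := #|[set a in A | a.2 == j]%SET|.

Definition nonempty_rows : nat := #|[set j : 'I_m | row_count j != 0%N]%SET|.

Definition max_row_count : nat := \max_(j < m) row_count j.

End Carpet.

Arguments carpet {n m} A R.

(* Main.v *)
Require Import Defs.
From mathcomp Require Import all_boot all_order all_algebra.
From mathcomp Require Import all_classical all_reals all_analysis.
From mathcomp Require Import ring lra zify.
Import Order.TTheory GRing.Theory Num.Theory.
Import numFieldNormedType.Exports.

Set Implicit Arguments.
Unset Strict Implicit.
Unset Printing Implicit Defensive.

Local Open Scope classical_set_scope.
Local Open Scope ring_scope.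

(** A point of the carpet is given by an address, a sequence of pairs
    (x_i, y_i) in A.  Fixing x_1, ..., x_l and y_1, ..., y_k confines the point
    to a rectangle of width n^-l and height m^-k; when n^-l and m^-k are
    comparable this is an approximate square of that size.  The Assouad
    dimension is the exponent in the largest possible number of approximate
    squares of size r inside one of size rho, that is, of pairs of levels
    (l + q, k + p) inside (l, k), where n^q and m^p are both comparable to
    rho / r.  As n > m, an approximate square has l <= k: its last y-digits are
    fixed while the x-digits at the same positions are still free.

    Upper bound (carpet_assouad_bound).  Refine the y-digits from level k to
    level k + p first: each new digit has at most s values.  Then refine the
    x-digits from l to l + q: since l + q <= k + p, the row of every new x-digit
    is already known, so it has at most t values.  Hence there are at most
    t^q s^p sub-squares (refine_cells), of order (rho / r)^(log_n t + log_m s),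
    and a ball meets boundedly many squares of its own size (near_prefixes).

    Lower bound (logb_sum_le_assouad_bound).  Given q, let l be so large that
    l + q <= k, which is possible as n^l outgrows m^(l+q).  In the square in
    which all y-digits between l and k name a row with t elements, the x-digits
    from l to l + q have t free values each and the y-digits from k to k + p
    have s free values each, independently; so the bound t^q s^p is attained
    (many_cells).  A ball of the size of the sub-squares meets at most nine of
    them (card_cells_le_cover).  An admissible exponent beta therefore satisfies
    n^(q alpha) <= K n^(q beta) for all q, where alpha is the claimed dimension,
    and so alpha <= beta. *)

(** * Digit expansions *)

(** The integer whose base-b digits are d 1, ..., d l: the base-b interval of
    level l that contains the number with digits d starts at
    digit_prefix b d l / b^l.  It is a short name for the first l digits. *)
Fixpoint digit_prefix (b : nat) (d : nat -> nat) (l : nat) : nat :=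
  if l is l'.+1 then (b * digit_prefix b d l' + d l'.+1)%N else 0%N.

Section Prefix.
Variable b : nat.
Hypothesis b_gt1 : (1 < b)%N.
Implicit Types d e : nat -> nat.

Lemma prefix_digits_inj d e l :
  (forall i, (d i < b)%N) -> (forall i, (e i < b)%N) ->
  digit_prefix b d l = digit_prefix b e l ->
  forall i, (1 <= i <= l)%N -> d i = e i.
Proof.
move=> dlt elt; elim: l => [|l IH] /=; first by move=> _ [|i] /andP[].
move=> E i /andP[i1].
have E1 : d l.+1 = e l.+1.
  by move/(congr1 (modn^~ b)) : E; rewrite /= ![(b * _)%N]mulnC !modnMDl !modn_small.
have E2 : digit_prefix b d l = digit_prefix b e l.
  move: E; rewrite E1 => /addIn/eqP; rewrite eqn_pmul2l ?(ltnW b_gt1)//.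
  by move/eqP.
rewrite leq_eqVlt => /orP[/eqP ->//|il].
by apply: IH => //; rewrite i1.
Qed.

Lemma eq_prefix d e l :
  (forall i, (1 <= i <= l)%N -> d i = e i) -> digit_prefix b d l = digit_prefix b e l.
Proof.
elim: l => //= l IH h; rewrite (h l.+1) ?ltnSn//; congr (b * _ + _)%N.
by apply: IH => i /andP[i1 il]; apply: h; rewrite i1 leqW.
Qed.

Variable R : realType.
Local Notation bR := (b%:R : R).

Let b_gt0 : 0 < bR. Proof. by rewrite ltr0n ltnW. Qed.
Let bX_gt0 l : 0 < bR ^+ l. Proof. exact: exprn_gt0. Qed.

Lemma partial_sum_prefix d l :
  \sum_(1 <= i < l.+1) ((d i)%:R / bR ^+ i) = (digit_prefix b d l)%:R / bR ^+ l.
Proof.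
elim: l => [|l IH]; first by rewrite big_geq// mul0r.
rewrite big_nat_recr //= IH natrD natrM mulrDl exprS.
by rewrite -mulf_div divff ?mul1r// gt_eqF.
Qed.

Lemma prefix_div_nondecreasing d :
  {homo (fun l => (digit_prefix b d l)%:R / bR ^+ l) : k l / (k <= l)%N >-> k <= l}.
Proof.
apply: homo_leq => //= [x y z|k]; first exact: le_trans.
rewrite ler_pdivlMr// exprS mulrCA mulfVK ?gt_eqF//.
by rewrite -natrM ler_nat /= leq_addr.
Qed.

Lemma prefixS_div_nonincreasing d : (forall i, (d i < b)%N) ->
  {homo (fun l => (digit_prefix b d l).+1%:R / bR ^+ l) : k l / (k <= l)%N >-> l <= k}.
Proof.
move=> dlt; apply: homo_leq => //= [x y z xy yz|k]; first exact: le_trans yz xy.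
rewrite ler_pdivrMr// exprS mulrCA mulfVK ?gt_eqF//.
by rewrite -natrM ler_nat /= mulnSr -addnS leq_add2l.
Qed.

(** The truncations from below increase and those from above decrease, and the
    latter bound the former; the series converges to a point in between. *)
Lemma digit_series_bounds d l : (forall i, (d i < b)%N) ->
  (digit_prefix b d l)%:R / bR ^+ l <= digit_series R b d <=
  (digit_prefix b d l).+1%:R / bR ^+ l.
Proof.
move=> dlt.
pose u N := (digit_prefix b d N)%:R / bR ^+ N.
have uE : (fun N => \sum_(1 <= i < N) ((d i)%:R / b%:R ^+ i : R)) =
          (fun N => u N.-1).
  by apply/funext => -[|N]; rewrite ?partial_sum_prefix// big_geq// /u/= mul0r.
have u_le k l' : u l' <= (digit_prefix b d k).+1%:R / bR ^+ k.
  apply: (@le_trans _ _ ((digit_prefix b d (maxn k l')).+1%:R / bR ^+ (maxn k l'))).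
    apply: (@le_trans _ _ (u (maxn k l'))).
      by apply: prefix_div_nondecreasing; rewrite leq_maxr.
    by rewrite ler_pM2r ?invr_gt0// ler_nat.
  by apply: prefixS_div_nonincreasing => //; rewrite leq_maxl.
have ucvg : cvgn (fun N => u N.-1).
  apply: nondecreasing_is_cvgn.
    by move=> x y xy; apply: prefix_div_nondecreasing; rewrite -!subn1 leq_sub2r.
  by exists ((digit_prefix b d 0).+1%:R / bR ^+ 0) => _ [N _ <-].
rewrite /digit_series uE; apply/andP; split.
  apply: limr_ge => //; exists l.+1 => // N /= lN.
  by apply: prefix_div_nondecreasing; case: N lN.
by apply: limr_le => //; near=> N.
Unshelve. all: by end_near. Qed.

Lemma same_prefix_close d e l :
  (forall i, (d i < b)%N) -> (forall i, (e i < b)%N) ->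
  digit_prefix b d l = digit_prefix b e l ->
  `|digit_series R b d - digit_series R b e| <= (bR ^+ l)^-1.
Proof.
move=> dlt elt E.
have /andP[] := digit_series_bounds l dlt; have /andP[] := digit_series_bounds l elt.
rewrite E -(natr1 (digit_prefix b e l)) mulrDl mul1r => e1 e2 d1 d2.
by rewrite ler_norml; lra.
Qed.

Lemma prefix_distance d e l (rho : R) :
  (forall i, (d i < b)%N) -> (forall i, (e i < b)%N) ->
  `|digit_series R b d - digit_series R b e| < rho ->
  (digit_prefix b d l)%:R < (digit_prefix b e l)%:R + rho * bR ^+ l + 1 :> R.
Proof.
move=> /(@digit_series_bounds d l)/andP[+ +] /(@digit_series_bounds e l)/andP[+ +].
rewrite !ler_pdivrMr// !ler_pdivlMr// -(natr1 (digit_prefix b d l)) -(natr1 (digit_prefix b e l)).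
move=> e1 e2 d1 d2; rewrite ltr_norml => /andP[_ h].
have: (digit_series R b d - digit_series R b e) * bR ^+ l < rho * bR ^+ l.
  by rewrite ltr_pM2r.
by rewrite mulrBl; lra.
Qed.

End Prefix.

(** * Counting refinements of an approximate square *)

Lemma prefix_add_div b d l j : (forall i, (d i < b)%N) ->
  (digit_prefix b d (l + j) %/ b ^ j)%N = digit_prefix b d l.
Proof.
move=> dlt; have b0 : (0 < b)%N := leq_ltn_trans (leq0n _) (dlt 0%N).
elim: j => [|j IH]; first by rewrite addn0 divn1.
rewrite addnS expnS divnMA /= [(b * digit_prefix _ _ _)%N]mulnC divnMDl//.
by rewrite (divn_small (dlt _)) addn0.
Qed.

Lemma digit_of_prefix b d l k : (forall i, (d i < b)%N) -> (l < k)%N ->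
  (digit_prefix b d k %/ b ^ (k - l.+1) %% b)%N = d l.+1.
Proof.
move=> dlt lk; rewrite -{1}(subnKC lk) prefix_add_div//= mulnC modnMDl.
by rewrite modn_small.
Qed.

Section Addresses.
Variables (n m : nat) (A : {set 'I_n * 'I_m}).
Implicit Types a : nat -> 'I_n * 'I_m.

Definition address a := forall i, (1 <= i)%N -> a i \in A.
Definition prefix_x a l := digit_prefix n (fun i => (a i).1) l.
Definition prefix_y a k := digit_prefix m (fun i => (a i).2) k.

(** Stated for any natural number y, since it is applied to a digit extracted
    from an integer. *)
Lemma row_count_max (y : nat) :
  (#|[set c in A | c.2 == y :> nat]%SET| <= max_row_count A)%N.
Proof.
have [ym|ym] := ltnP y m.
  exact: (leq_bigmax (F := row_count A) (Ordinal ym)).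
rewrite eq_card0// => c; rewrite !inE; apply/negP => /andP[_ /eqP cy].
by move: (ltn_ord c.2); rewrite cy ltnNge ym.
Qed.

(** Every further y-digit is the index of a non-empty row. *)
Lemma refine_rows l k p P Q : exists2 F : seq (nat * nat),
  (size F <= nonempty_rows A ^ p)%N &
  forall a, address a -> prefix_x a l = P -> prefix_y a k = Q ->
    (prefix_x a l, prefix_y a (k + p)) \in F.
Proof.
elim: p => [|p [F sF FP]].
  by exists [:: (P, Q)] => // a _ <- <-; rewrite addn0 inE.
pose rows := [set j : 'I_m | row_count A j != 0%N]%SET.
exists [seq (c.1, (m * c.2 + (j : 'I_m))%N) | c <- F, j <- enum rows].
  by rewrite size_allpairs -cardE expnSr leq_mul.
move=> a ca aP aQ; rewrite addnS.
apply/allpairsP; exists ((prefix_x a l, prefix_y a (k + p)), (a (k + p).+1).2).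
split => //=; first exact: FP.
rewrite mem_enum inE -lt0n; apply/card_gt0P; exists (a (k + p).+1).
by rewrite inE eqxx andbT ca.
Qed.

(** The y-digits are refined first.  The condition l + q <= k + p then makes the
    row of each new x-digit a function of the y-prefix, so that the x-digit has
    at most t values instead of n. *)
Lemma refine_cells l k q p P Q : (l + q <= k + p)%N ->
  exists2 F : seq (nat * nat),
  (size F <= max_row_count A ^ q * nonempty_rows A ^ p)%N &
  forall a, address a -> prefix_x a l = P -> prefix_y a k = Q ->
    (prefix_x a (l + q), prefix_y a (k + p)) \in F.
Proof.
elim: q => [_|q IH].
  by have [F sF FP] := refine_rows l k p P Q; exists F; [rewrite expn0 mul1n|rewrite addn0].
rewrite addnS => lk; have [F sF FP] := IH (ltnW lk).
pose row Q' := [set c in A | c.2 ==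
   (Q' %/ m ^ (k + p - (l + q).+1) %% m)%N :> nat]%SET.
exists [seq ((n * c.1 + (e : 'I_n * 'I_m).1)%N, c.2) | c <- F, e <- enum (row c.2)].
  rewrite expnS -mulnA; apply: leq_trans (leq_mul (leqnn _) sF).
  rewrite size_allpairs_dep; elim: (F) => //= c F' IHF.
  by rewrite mulnS leq_add// -cardE row_count_max.
move=> a ca aP aQ; apply/allpairsPdep.
exists (prefix_x a (l + q), prefix_y a (k + p)), (a (l + q).+1).
split => //=; first exact: FP.
by rewrite mem_enum inE ca//= digit_of_prefix.
Qed.

End Addresses.

(** * Euclidean distance, levels and logarithms *)

Section EuclideanDistance.
Variable R : realType.
Implicit Types p q : plane R.

Lemma normx_le_euclidean_dist p q : `|p.1 - q.1| <= euclidean_dist p q.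
Proof. by rewrite -sqrtr_sqr; apply: ler_wsqrtr; rewrite lerDl sqr_ge0. Qed.

Lemma normy_le_euclidean_dist p q : `|p.2 - q.2| <= euclidean_dist p q.
Proof. by rewrite -sqrtr_sqr; apply: ler_wsqrtr; rewrite lerDr sqr_ge0. Qed.

Lemma euclidean_dist_le_normD p q :
  euclidean_dist p q <= `|p.1 - q.1| + `|p.2 - q.2|.
Proof.
have := sqrt_add_sqr_triangle (p.1 - q.1) 0 0 (p.2 - q.2).
by rewrite addr0 add0r !expr0n /= addr0 add0r !sqrtr_sqr.
Qed.

End EuclideanDistance.

Section Depth.
Variable R : realType.
Implicit Types r : R.

(** The least level d such that b^-d < r / 2: two points in a common cell, both
    of whose sides are shorter than r / 2, are at distance less than r. *)
Definition depth (b : nat) r : nat := up_log b (Num.truncn (2 / r)).+1.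

Lemma depth_lt b r : (1 < b)%N -> 0 < r -> 2 / r < b%:R ^+ depth b r.
Proof.
move=> b1 r0; rewrite (lt_le_trans (truncnS_gt _))// -natrX ler_nat.
exact: up_logP.
Qed.

(** Minimality of the depth: one level less is too coarse, unless there is no
    coarser level. *)
Lemma depth_ge b r : (1 < b)%N -> 0 < r ->
  depth b r = 0%N \/ b%:R ^+ depth b r <= b%:R * (2 / r).
Proof.
move=> b1 r0; rewrite /depth; set N := Num.truncn _.
case: (posnP N) => [->|N0]; first by left; rewrite up_log1.
right; have := @up_log_gtn b N.+1 b1 N0.
have : (0 < up_log b N.+1)%N by rewrite up_log_gt0 b1.
case: (up_log b N.+1) => // d _; rewrite ltnS /= => dN.
rewrite exprS ler_wpM2l ?ler0n// -natrX; apply: (@le_trans _ _ N%:R).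
  by rewrite ler_nat.
by rewrite truncn_le divr_ge0// ltW.
Qed.

Lemma depth_le_base b c r : (1 < b)%N -> (b <= c)%N -> (depth c r <= depth b r)%N.
Proof.
move=> b1 bc; apply: up_log_min; first exact: leq_trans bc.
apply: leq_trans (up_logP _ b1) _.
by rewrite -/(depth b r); case: (depth b r) => // d; rewrite leq_exp2r.
Qed.

Lemma depth_le_radius b r1 r2 : 0 < r1 -> r1 <= r2 ->
  (depth b r2 <= depth b r1)%N.
Proof.
move=> r10 r12; apply/leq_up_log; rewrite ltnS; apply: le_truncn.
by rewrite ler_pM2l// lef_pV2// posrE (lt_le_trans r10).
Qed.

Lemma depth_difference b r rho : (1 < b)%N -> 0 < r -> r <= rho / 2 ->
  b%:R ^+ (depth b r - depth b (rho / 2)) <= b%:R * (rho / r).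
Proof.
move=> b1 r0 rrho; have rho0 : 0 < rho / 2 by exact: lt_le_trans rrho.
have z2 : 2 <= rho / r by rewrite ler_pdivlMr//; lra.
have b1R : 1 <= b%:R :> R by rewrite ler1n ltnW.
have ll := depth_le_radius b r0 rrho.
have [->|] := depth_ge b1 r0.
  by rewrite sub0n expr0; nra.
rewrite -{1}(subnK ll) exprD => h.
have lt := depth_lt b1 rho0.
have bl0 : 0 < b%:R ^+ depth b (rho / 2) :> R by rewrite exprn_gt0// ltr0n ltnW.
rewrite -(ler_pM2r bl0); apply: (le_trans h).
rewrite -mulrA ler_pM2l ?ltr0n 1?ltnW//.
have -> : 2 / r = (rho / r) * (1 / 2) * (2 / (rho / 2) ) by field; apply/andP; split; lra.
have zr0 : 0 < rho / r by lra.
rewrite -mulrA ler_pM2l//; lra.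
Qed.

End Depth.

Section Logarithm.
Variable R : realType.

Lemma powR_logb (b x : R) : 1 < b -> 0 < x -> b `^ logb b x = x.
Proof.
move=> b1 x0; rewrite /powR gt_eqF ?(lt_trans ltr01)//.
by rewrite /logb divfK ?lnK// gt_eqF// ln_gt0.
Qed.

Lemma powR_exprn_logb (b x : R) k : 1 < b -> 0 < x ->
  (b ^+ k) `^ logb b x = x ^+ k.
Proof.
move=> b1 x0; have b0 : 0 <= b by rewrite ltW// (lt_trans ltr01).
rewrite -powR_mulrn// -powRrM mulrC powRrM powR_logb// powR_mulrn//.
exact: ltW.
Qed.

Lemma logb_ge0 (b x : R) : 1 < b -> 1 <= x -> 0 <= logb b x.
Proof. by move=> b1 x1; rewrite divr_ge0// ln_ge0// ltW. Qed.

End Logarithm.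

(** * Covering a ball by cells *)

Section CarpetPoints.
Variables (R : realType) (n m : nat) (A : {set 'I_n * 'I_m}).
Hypotheses (n1 : (1 < n)%N) (m1 : (1 < m)%N).
Implicit Types a : nat -> 'I_n * 'I_m.

Local Notation X := (set_type (carpet A R)).

Lemma carpet_ball (x : X) (r : R) :
  ball x r = [set y : X | euclidean_dist (\val x) (\val y) < r].
Proof. by rewrite ballEmdist. Qed.

Lemma carpet_address (x : X) : exists2 a, address A a & \val x = carpet_point R a.
Proof. by have [a ca <-] := set_mem (valP x); exists a. Qed.

Lemma address_carpet a : address A a -> exists x : X, \val x = carpet_point R a.
Proof.
move=> ca; have h : carpet_point R a \in carpet A R by apply/mem_set; exists a.
by exists (Sub (carpet_point R a) h); rewrite SubK.
Qed.

Lemma same_cell_dist a a' l k :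
  prefix_x a l = prefix_x a' l -> prefix_y a k = prefix_y a' k ->
  euclidean_dist (carpet_point R a) (carpet_point R a') <=
  (n%:R ^+ l)^-1 + (m%:R ^+ k)^-1.
Proof.
move=> ex ey; apply: (le_trans (euclidean_dist_le_normD _ _)).
by rewrite lerD// same_prefix_close.
Qed.

(** A ball meets boundedly many base-b intervals of its own size.  At level 0
    there is a single interval, so that arbitrarily large radii need no separate
    treatment. *)
Lemma near_prefixes (b : nat) d e (rho : R) : (1 < b)%N -> 0 < rho ->
  (forall i, (d i < b)%N) -> (forall i, (e i < b)%N) ->
  `|digit_series R b d - digit_series R b e| < rho ->
  digit_prefix b d (depth b (rho / 2)) \in
    iota (digit_prefix b e (depth b (rho / 2)) - 4 * b) (8 * b + 1).
Proof.
move=> b1 rho0 dlt elt de; set l := depth b _; have rho20 : 0 < rho / 2 by lra.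
have lt_prefix f g : (forall i, (f i < b)%N) -> (forall i, (g i < b)%N) ->
    `|digit_series R b f - digit_series R b g| < rho ->
    (digit_prefix b f l < digit_prefix b g l + 4 * b + 1)%N.
  move=> flt glt fg; rewrite /l; case: (depth_ge b1 rho20) => [->|h].
    by rewrite addn1.
  have := prefix_distance b1 (depth b (rho / 2)) flt glt fg.
  rewrite -(@ltr_nat R) (natrD _ (_ + _)%N) (natrD _ (digit_prefix _ _ _)) natrM => /lt_le_trans; apply.
  have {h} : rho * b%:R ^+ depth b (rho / 2) <= rho * (b%:R * (2 / (rho / 2))).
    by rewrite ler_pM2l.
  have -> : rho * (b%:R * (2 / (rho / 2))) = 4 * b%:R by field; lra.
  lra.
have := lt_prefix _ _ dlt elt de; move: de; rewrite distrC => /lt_prefix.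
by move=> /(_ elt dlt); rewrite mem_iota; lia.
Qed.

Lemma refine_list l k q p (L : seq (nat * nat)) : (l + q <= k + p)%N ->
  exists2 F : seq (nat * nat),
  (size F <= size L * (max_row_count A ^ q * nonempty_rows A ^ p))%N &
  forall a, address A a -> (prefix_x a l, prefix_y a k) \in L ->
    (prefix_x a (l + q), prefix_y a (k + p)) \in F.
Proof.
move=> lk; elim: L => [|[P Q] L [F sF FP]]; first by exists [::].
have [G sG GP] := refine_cells A P Q lk.
exists (G ++ F); first by rewrite size_cat mulSn leq_add.
move=> a ca; rewrite inE mem_cat => /orP[/eqP[aP aQ]|aL].
  by rewrite GP.
by rewrite FP// orbT.
Qed.

(** The centres must be points of the carpet: one is chosen in each cell that
    meets the carpet, and x stands in for the other cells. *)
Lemma cover_ball_by_cells (x : X) (r rho : R) : (m < n)%N ->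
  0 < r -> r <= rho / 2 ->
  exists2 s : seq X,
    (size s <= ((8 * n + 1) * (8 * m + 1)) *
      (max_row_count A ^ (depth n r - depth n (rho / 2)) *
       nonempty_rows A ^ (depth m r - depth m (rho / 2))))%N &
    ball x rho `<=` \bigcup_(c in [set` s]) ball c r.
Proof.
move=> mn r0 rrho; have rho0 : 0 < rho by lra.
set l := depth n (rho / 2); set k := depth m (rho / 2).
set q := (_ - l)%N; set p := (_ - k)%N.
have lq : (l + q)%N = depth n r by rewrite subnKC// depth_le_radius.
have kp : (k + p)%N = depth m r by rewrite subnKC// depth_le_radius.
have [b _ xb] := carpet_address x.
pose L := [seq (P, Q) | P <- iota (prefix_x b l - 4 * n) (8 * n + 1),
                        Q <- iota (prefix_y b k - 4 * m) (8 * m + 1)].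
have [|F sF FP] := @refine_list l k q p L.
  by rewrite lq kp depth_le_base// ltnW.
pose in_cell (c : nat * nat) := [set y : X | exists a, [/\ address A a,
  \val y = carpet_point R a & (prefix_x a (l + q), prefix_y a (k + p)) = c]].
exists [seq xget x (in_cell c) | c <- F].
  by rewrite size_map; apply: leq_trans sF _; rewrite size_allpairs !size_iota.
move=> y; rewrite carpet_ball /= => xy.
have [a ca ya] := carpet_address y.
pose c := (prefix_x a (l + q), prefix_y a (k + p)).
have cF : c \in F.
  apply: FP => //; apply/allpairsP; exists (prefix_x a l, prefix_y a k).
  have dx := le_lt_trans (normx_le_euclidean_dist _ _) xy.
  have dy := le_lt_trans (normy_le_euclidean_dist _ _) xy.
  rewrite distrC in dx; rewrite distrC in dy.
  by split => //=; apply: near_prefixes => //; move: dx dy; rewrite xb ya.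
exists (xget x (in_cell c)); first exact: map_f.
have : in_cell c (xget x (in_cell c)) by apply: (@xgetPex _ x); exists y, a.
case=> a' [ca' ya' [ex ey]].
rewrite carpet_ball /= ya ya'; apply: le_lt_trans (same_cell_dist ex ey) _.
have := depth_lt n1 r0; have := depth_lt m1 r0; rewrite lq kp.
have inv_lt (z : R) : 2 / r < z -> z^-1 < r / 2.
  move=> h; have h0 : 0 < 2 / r by rewrite divr_gt0.
  have -> : r / 2 = (2 / r)^-1 by rewrite invf_div.
  by rewrite ltf_pV2// posrE// (lt_trans h0).
by move=> /inv_lt ? /inv_lt ?; lra.
Qed.

End CarpetPoints.

Lemma max_row_count_gt0 n m (A : {set 'I_n * 'I_m}) :
  A != finset.set0 -> (0 < max_row_count A)%N.
Proof.
move=> /finset.set0Pn[c cA]; apply: leq_trans (row_count_max A c.2).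
by apply/card_gt0P; exists c; rewrite inE cA eqxx.
Qed.

Lemma nonempty_rows_gt0 n m (A : {set 'I_n * 'I_m}) :
  A != finset.set0 -> (0 < nonempty_rows A)%N.
Proof.
move=> /finset.set0Pn[c cA]; apply/card_gt0P; exists c.2.
rewrite inE -lt0n; apply/card_gt0P; exists c.
by rewrite inE cA eqxx.
Qed.

(** The constant combines a bound for the number of cells that a ball meets with
    the factors t and s that rounding to integer levels costs: the number c^j of
    refinements by j levels is at most c (rho / r)^(log_b c), for b = n, c = t
    and for b = m, c = s. *)
Lemma carpet_assouad_bound (R : realType) n m (A : {set 'I_n * 'I_m}) (alpha : R) :
  (1 < m)%N -> (m < n)%N -> A != finset.set0 ->
  logb m%:R (nonempty_rows A)%:R + logb n%:R (max_row_count A)%:R <= alpha ->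
  assouad_bound (set_type (carpet A R)) alpha.
Proof.
move=> m1 mn A0; have n1 := ltn_trans m1 mn.
have := max_row_count_gt0 A0; have := nonempty_rows_gt0 A0.
set s := nonempty_rows A; set t := max_row_count A => s0 t0 h.
have growth (b c : nat) (r rho : R) : (1 < b)%N -> (0 < c)%N -> 0 < r ->
    r <= rho / 2 -> c%:R ^+ (depth b r - depth b (rho / 2)) <=
    c%:R * (rho / r) `^ logb b%:R c%:R.
  move=> b1 c0 r0 rrho; have z0 : 0 <= rho / r by rewrite divr_ge0; lra.
  have b1R : 1 < b%:R :> R by rewrite ltr1n.
  have c0R : 0 < c%:R :> R by rewrite ltr0n.
  rewrite -(powR_exprn_logb _ b1R c0R) -{2}(powR_logb b1R c0R) -powRM ?ler0n//.
  apply: ge0_ler_powR.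
  - by rewrite logb_ge0// ler1n.
  - by rewrite nnegrE exprn_ge0.
  - by rewrite nnegrE mulr_ge0.
  - exact: depth_difference.
exists (((8 * n + 1) * (8 * m + 1))%:R * (t%:R * s%:R)).
  by rewrite !mulr_gt0 ?ltr0n// muln_gt0 !addn1.
move=> r rho r0 rrho _ x.
have [S sS cover] := cover_ball_by_cells n1 m1 x mn r0 rrho.
exists S => //; move: sS; rewrite -(@ler_nat R) => /le_trans; apply.
rewrite natrM -!mulrA ler_wpM2l// natrM !natrX.
have z1 : 1 <= rho / r by rewrite ler_pdivlMr; lra.
set u := logb n%:R _ in h; set v := logb m%:R _ in h.
apply: (@le_trans _ _ ((t%:R * (rho / r) `^ u) * (s%:R * (rho / r) `^ v))).
  by apply: ler_pM; rewrite ?exprn_ge0 ?ler0n// growth.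
have -> : t%:R * (rho / r) `^ u * (s%:R * (rho / r) `^ v) =
    t%:R * (s%:R * (rho / r) `^ (v + u)).
  rewrite powRD; last by apply/implyP => _; rewrite gt_eqF// (lt_le_trans ltr01).
  by ring.
by rewrite !ler_wpM2l ?ler0n// ler_powR.
Qed.

(** * An approximate square with many cells *)

Section ManyCells.
Variables (n m : nat) (A : {set 'I_n * 'I_m}).
Hypotheses (n1 : (1 < n)%N) (m1 : (1 < m)%N) (A0 : A != finset.set0).

Lemma max_row_count_attained : exists2 c0, c0 \in A &
  #|[set c in A | c.2 == c0.2]%SET| = max_row_count A.
Proof.
have [j tj] : exists j, max_row_count A = row_count A j.
  have [|j tj] := @bigop.eq_bigmax _ (row_count A); last by exists j.
  by rewrite card_ord ltnW.
have /card_gt0P[c0] : (0 < row_count A j)%N by rewrite -tj max_row_count_gt0.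
rewrite inE => /andP[c0A /eqP c0j]; exists c0 => //.
by rewrite tj c0j.
Qed.

(** The addresses all start with l copies of c0, an element of a fullest row;
    then come q free elements of that row, whose y-digits are all equal, and,
    beyond position k, free rows, each represented by one of its elements.  The
    two blocks of free digits do not overlap because l + q <= k. *)
Lemma many_cells l q k p : (l + q <= k)%N ->
  exists (I : finType) (f : I -> nat -> 'I_n * 'I_m),
  [/\ #|I| = (max_row_count A ^ q * nonempty_rows A ^ p)%N,
      forall e, address A (f e),
      forall e e', prefix_x (f e) l = prefix_x (f e') l,
      forall e e', prefix_y (f e) k = prefix_y (f e') k &
      forall e e', prefix_x (f e) (l + q) = prefix_x (f e') (l + q) ->
        prefix_y (f e) (k + p) = prefix_y (f e') (k + p) -> e = e'].
Proof.
move=> lqk; have [c0 c0A row_c0] := max_row_count_attained.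
pose row := [set c in A | c.2 == c0.2]%SET.
pose rows := [set j : 'I_m | row_count A j != 0%N]%SET.
have c0row : c0 \in row by rewrite inE c0A eqxx.
have c0rows : c0.2 \in rows.
  by rewrite inE -lt0n; apply/card_gt0P; exists c0.
have repP (j : {j | j \in rows}) : exists c, (c \in A) && (c.2 == val j).
  case: j => j /=; rewrite inE -lt0n => /card_gt0P[c].
  by rewrite inE => cj; exists c.
pose rep j := xchoose (repP j).
(* Reading past the end of a tuple yields a fixed legal digit, so the address is
   also defined between l + q and k and beyond k + p. *)
pose xdig (u : q.-tuple {c | c \in row}) i := nth (Sub c0 c0row) u i.
pose ydig (v : p.-tuple {j | j \in rows}) i := nth (Sub c0.2 c0rows) v i.
pose f e i := if (i <= k)%N then
    if (i <= l)%N then c0 else val (xdig e.1 (i - l.+1)%N)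
  else rep (ydig e.2 (i - k.+1)%N).
exists ((q.-tuple {c | c \in row}) * (p.-tuple {j | j \in rows}))%type, f.
have xdigP u i : val (xdig u i) \in A /\ (val (xdig u i)).2 = c0.2.
  have : val (xdig u i) \in row by exact: valP.
  by rewrite inE => /andP[? /eqP ?].
have repA j : rep j \in A by have /andP[] := xchooseP (repP j).
have rep2 j : (rep j).2 = val j by have /andP[_ /eqP] := xchooseP (repP j).
have fl e i : (i <= l)%N -> f e i = c0.
  by move=> il; rewrite /f il (leq_trans il)// (leq_trans _ lqk)// leq_addr.
have fk e i : (i <= k)%N -> (f e i).2 = c0.2.
  by rewrite /f => ->; case: ifP => // _; have [] := xdigP e.1 (i - l.+1)%N.
have fx e i : (i < q)%N -> f e (l + i).+1 = val (xdig e.1 i).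
  move=> iq; rewrite /f (leq_trans _ lqk); last by rewrite -addnS leq_add2l.
  by rewrite ltnNge leq_addr /= subSS addKn.
have fy e i : f e (k + i).+1 = rep (ydig e.2 i).
  by rewrite /f ltnNge leq_addr /= subSS addKn.
split.
- by rewrite card_prod !card_tuple !card_sig row_c0.
- move=> e i _; rewrite /f; case: ifP => // _; case: ifP => // _.
  by have [] := xdigP e.1 (i - l.+1)%N.
- by move=> e e'; apply: eq_prefix => i /andP[_ il]; rewrite !fl.
- by move=> e e'; apply: eq_prefix => i /andP[_ ik]; rewrite !fk.
- move=> [u v] [u' v'] ex ey; congr (_, _); apply: val_inj.
    apply: (@eq_from_nth _ (Sub c0 c0row)); rewrite ?size_tuple// => i iq.
    have := prefix_digits_inj n1 (fun i => ltn_ord _) (fun i => ltn_ord _) ex.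
    move=> /(_ (l + i).+1); rewrite /= -addnS leq_add2l addnS /= !fx//= => h.
    apply: val_inj; apply/eqP; rewrite -pair_eqE /=; apply/andP; split.
      exact/eqP/val_inj/h.
    by apply/eqP; have [_ ->] := xdigP u i; have [_ ->] := xdigP u' i.
  apply: (@eq_from_nth _ (Sub c0.2 c0rows)); rewrite ?size_tuple// => i ip.
  have := prefix_digits_inj m1 (fun i => ltn_ord _) (fun i => ltn_ord _) ey.
  move=> /(_ (k + i).+1); rewrite /= -addnS leq_add2l addnS /= !fy !rep2 => h.
  exact/val_inj/val_inj/h.
Qed.

End ManyCells.

(** * Separation of cells *)

Lemma eq_of_mod N P Q : (P < Q + N)%N -> (Q < P + N)%N ->
  P = Q %[mod N] -> P = Q.
Proof.
wlog PQ : P Q / (P <= Q)%N => [th|_ QPN].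
  case/orP: (leq_total P Q) => [/th//|le PQN QPN /esym h].
  by symmetry; apply: th.
move=> /esym/eqP; rewrite eqn_mod_dvd// => /dvdn_leq; rewrite subn_gt0.
by move: QPN PQ; case: (ltnP P Q) => [_ + + /(_ isT)|]; lia.
Qed.

Section Separation.
Variables (R : realType) (n m : nat) (A : {set 'I_n * 'I_m}).
Hypotheses (m1 : (1 < m)%N) (mn : (m < n)%N).
Let n1 : (1 < n)%N. Proof. exact: ltn_trans mn. Qed.
Local Notation X := (set_type (carpet A R)).

Lemma prefix_distance3 (b : nat) d e l (c r : R) : (1 < b)%N ->
  (forall i, (d i < b)%N) -> (forall i, (e i < b)%N) -> r * b%:R ^+ l <= 1 ->
  `|c - digit_series R b d| < r -> `|c - digit_series R b e| < r ->
  (digit_prefix b d l < digit_prefix b e l + 3)%N.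
Proof.
move=> b1 dlt elt rl cd ce.
have de : `|digit_series R b d - digit_series R b e| < 2 * r.
  by move: cd ce; rewrite !ltr_norml => /andP[? ?] /andP[? ?]; apply/andP; split; lra.
have := prefix_distance b1 l dlt elt de.
by rewrite -(@ltr_nat R) natrD; lra.
Qed.

(** Two points in one ball of radius r have prefixes at distance at most 2 in
    both coordinates, so the residues modulo 3 of the prefixes tell apart the
    cells that meet the ball. *)
Lemma card_cells_le_cover (I : finType) (f : I -> nat -> 'I_n * 'I_m) l k
    (r : R) (s : seq X) :
  r * n%:R ^+ l <= 1 -> r * m%:R ^+ k <= 1 ->
  (forall e, exists2 c, c \in s &
    euclidean_dist (\val c) (carpet_point R (f e)) < r) ->
  (forall e e', prefix_x (f e) l = prefix_x (f e') l ->
    prefix_y (f e) k = prefix_y (f e') k -> e = e') ->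
  (#|I| <= size s * 9)%N.
Proof.
move=> rl rk cov finj.
have /boolp.choice[g gP] : forall e, exists i : 'I_(size s),
    euclidean_dist (\val (tnth (in_tuple s) i)) (carpet_point R (f e)) < r.
  move=> e; have [c cs ce] := cov e.
  have /tnthP[i ci] : c \in in_tuple s by [].
  by exists i; rewrite -ci.
pose mod3 P : 'I_3 := Ordinal (ltn_pmod P (isT : (0 < 3)%N)).
pose h e := (g e, mod3 (prefix_x (f e) l), mod3 (prefix_y (f e) k)).
have hinj : injective h.
  move=> e e' [gee' ex ey].
  have he := gP e; have he' := gP e'; rewrite -gee' in he'.
  have xe := le_lt_trans (normx_le_euclidean_dist _ _) he.
  have xe' := le_lt_trans (normx_le_euclidean_dist _ _) he'.
  have ye := le_lt_trans (normy_le_euclidean_dist _ _) he.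
  have ye' := le_lt_trans (normy_le_euclidean_dist _ _) he'.
  have nlt (a : nat -> 'I_n * 'I_m) i : ((a i).1 < n)%N := ltn_ord _.
  have mlt (a : nat -> 'I_n * 'I_m) i : ((a i).2 < m)%N := ltn_ord _.
  have x1 := prefix_distance3 n1 (nlt (f e)) (nlt (f e')) rl xe xe'.
  have x2 := prefix_distance3 n1 (nlt (f e')) (nlt (f e)) rl xe' xe.
  have y1 := prefix_distance3 m1 (mlt (f e)) (mlt (f e')) rk ye ye'.
  have y2 := prefix_distance3 m1 (mlt (f e')) (mlt (f e)) rk ye' ye.
  by apply: finj; [apply: (eq_of_mod x1 x2)|apply: (eq_of_mod y1 y2)].
have := leq_card h hinj.
by rewrite !card_prod !card_ord -mulnA.
Qed.

(** A digit is not determined by the number it helps to represent, but here two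
    digits suffice: the prefixes of equal numbers differ by at most 1, and those
    of distinct constant sequences differ at level 2 by at least b + 1. *)
Lemma constant_digit_series_inj (b : nat) (c d : 'I_b) : (1 < b)%N ->
  digit_series R b (fun=> c) = digit_series R b (fun=> d) -> c = d.
Proof.
move=> b1 E; have b0 : 0 < (b%:R : R) ^+ 2 by rewrite exprn_gt0// ltr0n ltnW.
have le (x y : 'I_b) :
    digit_series R b (fun=> x) = digit_series R b (fun=> y) -> (x <= y)%N.
  move=> xy; have := @prefix_distance b b1 R (fun=> x) (fun=> y) 2
    (b%:R ^+ 2)^-1 (fun=> ltn_ord x) (fun=> ltn_ord y).
  rewrite xy subrr normr0 invr_gt0 b0 mulVf ?gt_eqF// => /(_ isT).
  rewrite /= muln0 !add0n !natr1 ltr_nat.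
  by nia.
by apply: val_inj; apply: anti_leq; rewrite !le.
Qed.

Lemma carpet_two_points : (1 < #|A|)%N ->
  exists x y : X, 0 < euclidean_dist (\val x) (\val y).
Proof.
move=> /card_gt1P[c [d [cA dA cd]]].
have [x xc] : exists x : X, \val x = carpet_point R (fun=> c).
  by apply: address_carpet.
have [y yd] : exists y : X, \val y = carpet_point R (fun=> d).
  by apply: address_carpet.
exists x, y; rewrite lt_neqAle sqrtr_ge0 andbT eq_sym; apply/negP => /eqP.
rewrite xc yd => /euclidean_dist_positivity[] E1 E2; case/eqP: cd.
have := constant_digit_series_inj n1 E1; have := constant_digit_series_inj m1 E2.
by case: c d {cA dA xc yd E1 E2} => [? ?] [? ?] /= -> ->.
Qed.

End Separation.

(** * The lower bound *)

(** By Bernoulli's inequality n^l >= (m + 1)^l >= l m^(l-1), and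
    l >= m^(q+1). *)
Lemma expn_lt_base m n q l : (m < n)%N -> (m ^ q.+1 <= l)%N ->
  (m ^ (l + q) <= n ^ l)%N.
Proof.
move=> mn; case: l => [|l] ml.
  by move: ml; rewrite leqn0 expn_eq0 andbT => /eqP ->; case: q => // q; rewrite exp0n.
have bern : (m ^ l.+1 + l.+1 * m ^ l <= m.+1 ^ l.+1)%N.
  elim: (l) => [|i IH]; first by rewrite !expn1 expn0 muln1 addn1.
  by rewrite expnS [(_ ^ i.+2)%N in X in (_ <= X)%N]expnS; rewrite expnS in IH *; nia.
apply: leq_trans (_ : m.+1 ^ l.+1 <= _)%N; last by rewrite leq_exp2r.
apply: leq_trans bern; apply: leq_trans (leq_addl _ _).
by rewrite addSnnS addnC expnD leq_mul2r ml orbT.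
Qed.

Lemma powR_exprn_unbounded (R : realType) (b alpha beta K : R) : 1 < b ->
  beta < alpha -> exists q, K * (b ^+ q) `^ beta < (b ^+ q) `^ alpha.
Proof.
move=> b1 ba; have b0 : 0 < b := lt_trans ltr01 b1.
set x := b `^ (alpha - beta).
have x1 : 1 < x by rewrite /x /powR gt_eqF// expR_gt1 mulr_gt0 ?subr_gt0// ln_gt0.
have bern q : 1 + q%:R * (x - 1) <= x ^+ q.
  elim: q => [|q IH]; first by rewrite mul0r addr0.
  have x0 : 0 <= x by rewrite ltW// (lt_trans ltr01).
  rewrite exprS -natr1; apply: le_trans (ler_wpM2l x0 IH).
  rewrite -subr_ge0; have := mulr_ge0 (ler0n R q) (sqr_ge0 (x - 1)).
  by congr (0 <= _); ring.
pose q := (Num.truncn (K / (x - 1))).+1.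
exists q; have Kq : K < x ^+ q.
  have := truncnS_gt (K / (x - 1)); rewrite -/q ltr_pdivrMr ?subr_gt0// => h.
  by apply: lt_le_trans (bern q); lra.
have bq0 : 0 < b ^+ q by exact: exprn_gt0.
have -> : alpha = (alpha - beta) + beta by ring.
rewrite powRD; last by apply/implyP => _; rewrite gt_eqF.
suff -> : (b ^+ q) `^ (alpha - beta) = x ^+ q by rewrite ltr_pM2r ?powR_gt0.
by rewrite -(powR_mulrn _ (ltW b0)) -(powR_mulrn _ (powR_ge0 _ _)) -!powRrM mulrC.
Qed.

Section LowerBound.
Variables (R : realType) (n m : nat) (A : {set 'I_n * 'I_m}).
Hypotheses (m1 : (1 < m)%N) (mn : (m < n)%N) (A0 : A != finset.set0).
Let n1 : (1 < n)%N. Proof. exact: ltn_trans mn. Qed.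
Local Notation X := (set_type (carpet A R)).
Local Notation s := (nonempty_rows A).
Local Notation t := (max_row_count A).

(** For given q, the assumed bound is applied to a ball containing the square of
    many_cells, with r the width of its cells.  The two points x1 and x2 at
    positive distance ensure that this ball is admissible when it is small. *)
Lemma assouad_bound_growth (beta : R) (x1 x2 : X) :
  0 < beta -> 0 < euclidean_dist (\val x1) (\val x2) ->
  assouad_bound X beta ->
  exists K : R, forall q,
    (n%:R ^+ q) `^ (logb m%:R s%:R + logb n%:R t%:R) <= K * (n%:R ^+ q) `^ beta.
Proof.
set delta := euclidean_dist _ _ => beta0 delta0 [C C0 bound].
exists (s%:R * (9 * C * (3 * m%:R) `^ beta)) => q.
(* The first term makes l + q <= k, the second makes the ball small compared
   with the diameter. *)
pose l := maxn (m ^ q.+1) (Num.truncn (3 / (2 * delta))).+1.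
pose k := trunc_log m (n ^ l).
pose k' := trunc_log m (n ^ (l + q)).
pose p := (k' - k)%N.
have n0 : (0 < n)%N by rewrite ltnW.
have m0 : (0 < m)%N by rewrite ltnW.
have lqk : (l + q <= k)%N by rewrite trunc_log_max// expn_lt_base// leq_maxl.
have lk : (l <= k)%N by rewrite (leq_trans _ lqk)// leq_addr.
have kk' : (k <= k')%N by rewrite leq_trunc_log// leq_pexp2l// leq_addr.
have kp : (k + p)%N = k' by rewrite subnKC.
have mk : (m ^ k <= n ^ l)%N by rewrite trunc_logP// expn_gt0 n0.
have mk' : (m ^ k' <= n ^ (l + q))%N by rewrite trunc_logP// expn_gt0 n0.
have nl : (n ^ l <= m * m ^ k)%N by rewrite -expnS ltnW// trunc_log_ltn.
have nlq : (n ^ (l + q) <= m * m ^ k')%N by rewrite -expnS ltnW// trunc_log_ltn.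
have nR : 1 < n%:R :> R by rewrite ltr1n.
have mR : 1 < m%:R :> R by rewrite ltr1n.
have n0R : 0 < n%:R :> R by rewrite ltr0n.
have m0R : 0 < m%:R :> R by rewrite ltr0n.
have nl0 i : 0 < n%:R ^+ i :> R by rewrite exprn_gt0.
have mk0 i : 0 < m%:R ^+ i :> R by rewrite exprn_gt0.
move: mk mk' nl nlq; rewrite -!(@ler_nat R) !natrM !natrX => mk mk' nl nlq.
have [I [f [cardI fA fx fy finj]]] := many_cells n1 m1 A0 p lqk.
have s0 := nonempty_rows_gt0 A0; have t0 := max_row_count_gt0 A0.
have /card_gt0P[e0 _] : (0 < #|I|)%N by rewrite cardI muln_gt0 !expn_gt0 s0 t0.
have [x0 x0E] := address_carpet R (fA e0).
pose rho : R := 3 / m%:R ^+ k; pose r : R := (n%:R ^+ (l + q))^-1.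
have r0 : 0 < r by rewrite invr_gt0.
have nlnlq : n%:R ^+ l <= n%:R ^+ (l + q) :> R.
  by rewrite ler_eXn2l// leq_addr.
have rhoE : rho / r = 3 * n%:R ^+ (l + q) / m%:R ^+ k by rewrite /rho /r invrK mulrAC.
have rrho : r <= rho / 2.
  rewrite ler_pdivlMr// mulrC -ler_pdivlMr// rhoE ler_pdivlMr//.
  by have := le_trans mk nlnlq; have := mk0 k; lra.
have rho_diam : ((rho / 2)%:E <= @diameter R X)%E.
  apply: le_ereal_sup_tmp; exists delta%:E; first by exists x1, x2.
  rewrite lee_fin /rho.
  have le_l : 3 / (2 * delta) <= m%:R ^+ k.
    apply: (@le_trans _ _ l%:R).
      by apply/ltW/(lt_le_trans (truncnS_gt _)); rewrite ler_nat leq_maxr.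
    rewrite -natrX ler_nat (leq_trans (ltnW (ltn_expl l m1)))//.
    by rewrite leq_pexp2l.
  move: le_l; rewrite ler_pdivrMr ?mulr_gt0// => le_l.
  rewrite -mulrA -invfM ler_pdivrMr ?mulr_gt0//.
  by lra.
have [S sizeS cover] := bound _ _ r0 rrho rho_diam x0.
have : (#|I| <= size S * 9)%N.
  apply: (@card_cells_le_cover R n m A m1 mn I f (l + q) (k + p) r) finj.
  - by rewrite /r mulVf// gt_eqF.
  - by rewrite kp /r mulrC ler_pdivrMr ?mul1r.
  move=> e; have [y yE] := address_carpet R (fA e).
  have [c cS] : (\bigcup_(c in [set` S]) ball c r) y.
    apply: cover; rewrite carpet_ball /= x0E yE.
    apply: le_lt_trans (same_cell_dist R n1 m1 (fx e0 e) (fy e0 e)) _.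
    have : (n%:R ^+ l)^-1 <= (m%:R ^+ k)^-1 :> R by rewrite lef_pV2 ?posrE.
    have : 0 < (m%:R ^+ k)^-1 :> R by rewrite invr_gt0.
    by rewrite /rho; lra.
  by rewrite carpet_ball /= yE; exists c.
rewrite cardI -(@ler_nat R) !natrM !natrX => count.
have {}count : t%:R ^+ q * s%:R ^+ p <= 9 * (C * (rho / r) `^ beta).
  by apply: (le_trans count); rewrite mulrC ler_pM2l.
have t0R : 0 < t%:R :> R by rewrite ltr0n.
have s0R : 0 < s%:R :> R by rewrite ltr0n.
(* k and k' are rounded down to integers, so p may fall short of log_m (n^q) by
   less than one level; this is the extra factor s. *)
have step1 : (n%:R ^+ q) `^ (logb m%:R s%:R) <= s%:R * s%:R ^+ p :> R.
  rewrite -exprS -(powR_exprn_logb _ mR s0R); apply: ge0_ler_powR.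
  - by rewrite logb_ge0// ler1n.
  - by rewrite nnegrE ltW.
  - by rewrite nnegrE ltW.
  - rewrite -(ler_pM2l (nl0 l)) -exprD (le_trans nlq)//.
    rewrite -kp exprD mulrCA -exprS.
    by rewrite ler_pM2r.
have step2 : (rho / r) `^ beta <= (3 * m%:R) `^ beta * (n%:R ^+ q) `^ beta.
  rewrite -powRM ?(ltW (nl0 _)) ?mulr_ge0 ?(ltW m0R)//.
  apply: ge0_ler_powR; first exact: ltW.
  - by rewrite nnegrE rhoE ltW// divr_gt0// mulr_gt0.
  - by rewrite nnegrE ltW// !mulr_gt0.
  rewrite rhoE ler_pdivrMr// exprD.
  have := nl0 q; nra.
rewrite powRD; last by apply/implyP => _; rewrite gt_eqF.
rewrite powR_exprn_logb//.
have t0q : 0 < t%:R ^+ q :> R by rewrite exprn_gt0.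
apply: (@le_trans _ _ (s%:R * s%:R ^+ p * t%:R ^+ q)); first by rewrite ler_pM2r.
rewrite -!mulrA ler_pM2l// mulrC (le_trans count)// ler_pM2l// ler_pM2l//.
Qed.

(** If A is a singleton the carpet is a point, and the claim holds because both
    logarithms vanish. *)
Lemma logb_sum_le_assouad_bound (beta : R) :
  0 < beta -> assouad_bound X beta ->
  logb m%:R s%:R + logb n%:R t%:R <= beta.
Proof.
move=> beta0 bound; have [A1|A1] := leqP #|A| 1.
  have s1 : s = 1%N.
    apply/eqP; rewrite eqn_leq nonempty_rows_gt0// andbT.
    apply: leq_trans A1; apply: leq_trans (leq_imset_card (fun c => c.2) A).
    apply/subset_leq_card/fintype.subsetP => j; rewrite inE -lt0n => /card_gt0P[c].
    by rewrite inE => /andP[cA /eqP <-]; apply: imset_f.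
  have t1 : t = 1%N.
    apply/eqP; rewrite eqn_leq max_row_count_gt0// andbT.
    apply: leq_trans A1; apply/bigmax_leqP => j _.
    by apply/subset_leq_card/fintype.subsetP => c; rewrite inE => /andP[].
  by rewrite s1 t1 /logb ln1 !mul0r addr0 ltW.
have [x1 [x2 x12]] := carpet_two_points R m1 mn A1.
rewrite leNgt; apply/negP => lt_beta.
have nR : 1 < n%:R :> R by rewrite ltr1n.
have [K growth] := assouad_bound_growth beta0 x12 bound.
by have [q] := powR_exprn_unbounded K nR lt_beta; rewrite ltNge growth.
Qed.

End LowerBound.

Theorem theorem1p1 (R : realType) (n m : nat) (A : {set 'I_n * 'I_m})
    (hm : (2 <= m)%N) (hmn : (m < n)%N) (hA : A != finset.set0) :
  assouad_dim (set_type (carpet A R)) =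
  (logb m%:R (nonempty_rows A)%:R + logb n%:R (max_row_count A)%:R)%:E.
Proof.
set alpha := _ + _.
have alpha0 : 0 <= alpha.
  by rewrite addr_ge0// logb_ge0 ?ltr1n ?ler1n ?nonempty_rows_gt0
    ?max_row_count_gt0// (ltn_trans hm).
apply/eqP; rewrite eq_le; apply/andP; split.
  apply/lee_addgt0Pr => e e0; apply: ge_ereal_inf.
  exists (alpha + e)%:E => //; exists (alpha + e) => //; split.
    exact: ltr_wpDl.
  by apply: carpet_assouad_bound => //; rewrite lerDl ltW.
apply: le_ereal_inf_tmp => _ [beta [beta0 bound] <-]; rewrite lee_fin.
exact: logb_sum_le_assouad_bound.
Qed.
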